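(* Let $T$ be a tree with $n$ vertices. Then \[ \mathcal{B}_{n-1}=\{d(\mathcal{M},X)\mid \mathcal{M}\in\mathcal{V}_2^*(T^\ell,n-1)\} \] is a reduced Gröbner basis of $I_{n-1}(T,X)$ with respect to the degree lexicographic order.
   Context: A tree is a simple connected graph without cycles. Label the vertices $v_1,\dots,v_n$ and write $x_i=x_{v_i}$. The generalized Laplacian $L(T,X)$ has diagonal entries $x_i$ and off-diagonal entry $-1$ for adjacent vertices, $0$ otherwise; $I_j(T,X)\subseteq\mathbb{Z}[x_1,\dots,x_n]$ is the ideal generated by all $j\times j$ minors of $L(T,X)$. A $2$-matching of a graph (loops allowed) is a set $\mathcal{M}$ of edges such that every vertex is incident to at most two edges of $\mathcal{M}$ (a loop counts twice for incidence but as one edge). $T^\ell$ is $T$ with a loop added at each vertex; $\ell(\mathcal{M})$ is the set of loops in $\mathcal{M}$. A $2$-matching $\mathcal{M}$ of $T^\ell$ is minimal if there is no $2$-matching $\mathcal{M}'$ of $T^\ell$ with $|\mathcal{M}'|=|\mathcal{M}|$ and $\ell(\mathcal{M}')\subsetneq\ell(\mathcal{M})$; $\mathcal{V}_2^*(T^\ell,j)$ is the set of minimal $2$-matchings of size $j$. Components of $\mathcal{M}$ are single loops or paths of $T$; orient each path $w_1\cdots w_{m+1}$ (either direction), with heads $\{w_2,\dots,w_{m+1}\}$ and tails $\{w_1,\dots,w_m\}$, a loop $uu$ having head and tail $u$; $h(\mathcal{M})$, $t(\mathcal{M})$ are the unions of heads, resp. tails. $d(\mathcal{M},X)=\pm\det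 L(T,X)[h(\mathcal{M}),t(\mathcal{M})]$ with the sign making the leading coefficient positive. Degree lexicographic order: $x^\alpha\prec x^\beta$ if $\sum\alpha_i<\sum\beta_i$, or the sums are equal and for the first index $i$ with $\alpha_i\neq\beta_i$ one has $\alpha_i<\beta_i$. For $p\in\mathbb{Z}[x]$, $\mathrm{lp}(p)$, $\mathrm{lc}(p)$, $\mathrm{lt}(p)=\mathrm{lc}(p)\mathrm{lp}(p)$ are its leading power (monomial), coefficient and term. A finite set $B$ of nonzero polynomials in an ideal $I$ is a Gröbner basis of $I$ if $\langle \mathrm{lt}(b)\mid b\in B\rangle=\langle \mathrm{lt}(f)\mid f\in I\rangle$; it is reduced if $\mathrm{lc}(b)=1$ for all $b\in B$ and no nonzero term of any $b_i\in B$ is divisible by $\mathrm{lp}(b_j)$ for $b_j\in B$, $j\neq i$. *)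

(* Defs.v *)
From HB Require Import structures.
From mathcomp Require Import all_boot all_order all_algebra.
From mathcomp Require Import mpoly.
Set Implicit Arguments. Unset Strict Implicit. Unset Printing Implicit Defensive.
Import Order.TTheory GRing.Theory Num.Theory.
Local Open Scope ring_scope.

Definition is_tree (n : nat) (adj : rel 'I_n) : Prop :=
  [/\ (0 < n)%N, ssrbool.symmetric adj, irreflexive adj,
      (forall u v : 'I_n, connect adj u v) &
      ~ (exists (x : 'I_n) (s : seq 'I_n),
           [/\ (2 <= size s)%N, uniq (x :: s), path adj x s & adj (last x s) x])].

(* Edges of T^l : a loop {u} (encoded [set u]) or an edge {u,v} of T. *)
Definition is_edge_loop (n : nat) (adj : rel 'I_n) (e : {set 'I_n}) : Prop :=
  (exists u, e = [set u]) \/ (exists u v, adj u v /\ e = [set u; v]).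

Definition is_loop (n : nat) (e : {set 'I_n}) : bool := #|e| == 1%N.

Definition incidence (n : nat) (M : {set {set 'I_n}}) (v : 'I_n) : nat :=
  (#|[set e in M | (v \in e) && ~~ is_loop e]| + 2 * #|[set e in M | e == [set v]]|)%N.

Definition two_matching (n : nat) (adj : rel 'I_n) (M : {set {set 'I_n}}) : Prop :=
  (forall e, e \in M -> is_edge_loop adj e) /\ (forall v, (incidence M v <= 2)%N).

Definition loops (n : nat) (M : {set {set 'I_n}}) : {set {set 'I_n}} :=
  [set e in M | is_loop e].

Definition minimal_two_matching (n : nat) (adj : rel 'I_n) (j : nat)
    (M : {set {set 'I_n}}) : Prop :=
  [/\ two_matching adj M, #|M| = j &
      ~ (exists M', [/\ two_matching adj M', #|M'| = j & loops M' \proper loops M])].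

(* An orientation of the path components of M: a direction D u v (u -> v) for
   every non-loop edge {u,v} of M, such that every vertex has in- and
   out-degree at most one (i.e. each path w_1...w_{m+1} is oriented w_i -> w_{i+1}). *)
Definition orientation (n : nat) (M : {set {set 'I_n}}) (D : rel 'I_n) : Prop :=
  [/\ (forall u v, D u v -> u != v /\ [set u; v] \in M),
      (forall e, e \in M -> ~~ is_loop e ->
         exists u v, e = [set u; v] /\ (D u v (+) D v u)),
      (forall v, (#|[set u | D u v]| <= 1)%N) &
      (forall u, (#|[set v | D u v]| <= 1)%N)].

Definition heads (n : nat) (M : {set {set 'I_n}}) (D : rel 'I_n) : {set 'I_n} :=
  [set v | ([set v] \in M) || [exists u, D u v]].
Definition tails (n : nat) (M : {set {set 'I_n}}) (D : rel 'I_n) : {set 'I_n} :=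
  [set u | ([set u] \in M) || [exists v, D u v]].

Definition gen_laplacian (n : nat) (adj : rel 'I_n) : 'M[{mpoly int[n]}]_n :=
  \matrix_(i, j) (if i == j then 'X_i else if adj i j then -1 else 0).

Definition strictly_increasing (k n : nat) (f : 'I_k -> 'I_n) : Prop :=
  forall a b : 'I_k, (a < b)%N -> (f a < f b)%N.

Definition is_minor (R : comNzRingType) (n j : nat) (A : 'M[R]_n) (p : R) : Prop :=
  exists f g : 'I_j -> 'I_n,
    [/\ strictly_increasing f, strictly_increasing g & p = \det (mxsub f g A)].

Definition in_ideal (R : comNzRingType) (S : R -> Prop) (p : R) : Prop :=
  exists k (g c : 'I_k -> R), (forall i, S (g i)) /\ p = \sum_(i < k) c i * g i.

Definition I_ideal (n : nat) (adj : rel 'I_n) (j : nat) : {mpoly int[n]} -> Prop :=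
  in_ideal (is_minor j (gen_laplacian adj)).

Definition lex_lt (n : nat) (a b : 'X_{1..n}) : bool :=
  [exists i : 'I_n, [forall k : 'I_n, (k < i)%N ==> (a k == b k)] && (a i < b i)%N].

Definition deglex_lt (n : nat) (a b : 'X_{1..n}) : bool :=
  (mdeg a < mdeg b)%N || ((mdeg a == mdeg b) && lex_lt a b).

Definition deglex_max (n : nat) (a b : 'X_{1..n}) : 'X_{1..n} :=
  if deglex_lt a b then b else a.

(* leading power (monomial); for p = 0 it is the constant monomial *)
Definition lp (n : nat) (p : {mpoly int[n]}) : 'X_{1..n} :=
  foldr (@deglex_max n) 0%MM (msupp p).
Definition lc (n : nat) (p : {mpoly int[n]}) : int := p@_(lp p).
Definition lterm (n : nat) (p : {mpoly int[n]}) : {mpoly int[n]} := lc p *: 'X_[lp p].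

Definition mdivides (n : nat) (a b : 'X_{1..n}) : bool := [forall i, a i <= b i]%N.

Definition groebner_basis (n : nat) (I B : {mpoly int[n]} -> Prop) : Prop :=
  [/\ (exists s : seq {mpoly int[n]}, forall p, B p <-> p \in s),
      (forall b, B b -> b != 0 /\ I b) &
      (forall q, in_ideal (fun t => exists b, B b /\ t = lterm b) q <->
                 in_ideal (fun t => exists f, I f /\ t = lterm f) q)].

Definition reduced_groebner_basis (n : nat) (I B : {mpoly int[n]} -> Prop) : Prop :=
  [/\ groebner_basis I B,
      (forall b, B b -> lc b = 1) &
      (forall bi bj, B bi -> B bj -> bi != bj ->
         forall m, m \in msupp bi -> ~~ mdivides (lp bj) m)].

Definition is_dMX (n : nat) (adj : rel 'I_n) (M : {set {set 'I_n}})
    (p : {mpoly int[n]}) : Prop :=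
  exists (D : rel 'I_n) (f g : 'I_#|M| -> 'I_n),
    [/\ orientation M D, strictly_increasing f, strictly_increasing g,
        [set f i | i in 'I_#|M|] = heads M D &
        [set g i | i in 'I_#|M|] = tails M D] /\
        ((p = \det (mxsub f g (gen_laplacian adj)) \/
         p = - \det (mxsub f g (gen_laplacian adj))) /\ 0 < lc p).

Definition B_set (n : nat) (adj : rel 'I_n) (j : nat) : {mpoly int[n]} -> Prop :=
  fun p => exists M, minimal_two_matching adj j M /\ is_dMX adj M p.

(* Main.v *)
(* Let d_B be the principal minor of L(T,X) on a vertex set B; its leading
   monomial is the product of the x_i, i in B, and every other monomial divides
   it.  If M has n-1 edges, cutting T at an edge of M shows that every nonzero
   term of the minor L[h(M),t(M)] uses all the path edges of M, so that
   d(M,X) = d_B with B the set of looped vertices; reducedness follows.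

   For the Groebner property let B1, B2, B3 be three branches of T at a vertex v.
   An (n-1)-minor deletes a column outside two of them, hence lies in
   <d_B1, d_B2, d_B3>.  These generators have pairwise coprime leading monomials,
   so the leading monomial of any f in I_(n-1) is divisible by that of some
   d_Bi.  Thus the set Z of vertices whose variable does not occur in lp(f)
   never meets three branches at the same vertex, so Z lies on a path of T, and
   this path together with loops at all other vertices is a 2-matching whose
   loop monomial divides lp(f). *)
Require Import Defs.
From mathcomp Require Import all_boot all_order all_fingroup all_algebra.
From mathcomp Require Import mpoly ring zify.
From Stdlib Require Import Classical_Prop.
Set Implicit Arguments. Unset Strict Implicit. Unset Printing Implicit Defensive.
Import Order.TTheory GRing.Theory Num.Theory.
Local Open Scope ring_scope.

(** * Ideals *)

Lemma in_ideal_gen (R : comNzRingType) (S : R -> Prop) (p : R) :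
  S p -> in_ideal S p.
Proof.
by exists 1, (fun=> p), (fun=> 1); split=> //; rewrite big_ord1 mul1r.
Qed.

Lemma in_ideal0 (R : comNzRingType) (S : R -> Prop) : in_ideal S 0.
Proof. by exists 0, (fun=> 0), (fun=> 0); split=> [[]//|]; rewrite big_ord0. Qed.

Lemma in_idealMl (R : comNzRingType) (S : R -> Prop) (a p : R) :
  in_ideal S p -> in_ideal S (a * p).
Proof.
case=> k [g [c [Sg ->]]]; exists k, g, (fun i => a * c i); split=> //.
by rewrite mulr_sumr; apply: eq_bigr => i _; rewrite mulrA.
Qed.

Lemma in_idealD (R : comNzRingType) (S : R -> Prop) (p q : R) :
  in_ideal S p -> in_ideal S q -> in_ideal S (p + q).
Proof.
case=> k [g [c [Sg ->]]] [k' [g' [c' [Sg' ->]]]].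
pose u (a : 'I_k -> R) (b : 'I_k' -> R) (i : 'I_(k + k')) :=
  match fintype.split i with inl i1 => a i1 | inr i2 => b i2 end.
exists (k + k')%N, (u g g'), (u c c'); split.
  by move=> i; rewrite /u; case: fintype.split.
rewrite big_split_ord; congr (_ + _); apply: eq_bigr => i _; rewrite /u.
  by rewrite (unsplitK (inl i)).
by rewrite (unsplitK (inr i)).
Qed.

Lemma in_ideal_sub (R : comNzRingType) (S S' : R -> Prop) (p : R) :
  (forall q, S q -> in_ideal S' q) -> in_ideal S p -> in_ideal S' p.
Proof.
move=> SS' [k [g [c [Sg ->]]]].
apply: big_ind => [||i _]; [exact: in_ideal0 | exact: in_idealD |].
exact/in_idealMl/SS'.
Qed.

(** A representation of the generators passes to the ideal by linearity; this gives the explicit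
    cofactors that [mlead_coprime3] takes. *)
Lemma in_ideal_span3 (R : comNzRingType) (S : R -> Prop) (a b c p : R) :
  (forall q, S q -> exists q1 q2 q3, q = q1 * a + q2 * b + q3 * c) ->
  in_ideal S p -> exists q1 q2 q3, p = q1 * a + q2 * b + q3 * c.
Proof.
move=> Sabc [k [g [s [Sg ->]]]].
apply: (big_ind (fun p => exists q1 q2 q3, p = q1 * a + q2 * b + q3 * c)).
- by exists 0, 0, 0; rewrite !mul0r !addr0.
- move=> _ _ [q1 [q2 [q3 ->]]] [r1 [r2 [r3 ->]]].
  by exists (q1 + r1), (q2 + r2), (q3 + r3); ring.
move=> i _; have [q1 [q2 [q3 ->]]] := Sabc _ (Sg i).
by exists (s i * q1), (s i * q2), (s i * q3); ring.
Qed.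

(** * Leading monomials *)

(** Identifies the order with the one that [mpoly] puts on monomials, which makes the theory of
    [mlead] available. *)
Lemma deglex_ltE (n : nat) (a b : 'X_{1..n}) : deglex_lt a b = (a < b)%O.
Proof.
rewrite /deglex_lt; case: (ltngtP (mdeg a) (mdeg b)) => [h|h|h] /=.
- by rewrite lt_mdeg_ltmc.
- by apply/esym/negbTE; rewrite -leNgt ltW // lt_mdeg_ltmc.
apply/existsP/(ltmcP h) => [[i /andP[/forallP eqi lti]]|[i eqi lti]].
  by exists i => // j ji; apply/eqP/(implyP (eqi j)).
by exists i; rewrite lti andbT; apply/forallP => j; apply/implyP => /eqi ->.
Qed.

Lemma lp_mlead (n : nat) (p : {mpoly int[n]}) : lp p = mlead p.
Proof.
rewrite /lp /mlead; elim: (msupp p) => [|m s IH] /=; first by rewrite big_nil.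
rewrite big_cons IH /deglex_max deglex_ltE.
by case: leP.
Qed.

(** * Division with remainder and coprime leading monomials *)

Lemma ltm_mlead_sub (n : nat) (p q : {mpoly int[n]}) :
  mlead p = mlead q -> p@_(mlead p) = q@_(mlead p) -> p - q != 0 ->
  (mlead (p - q) < mlead p)%O.
Proof.
move=> eqpq eqc nz; rewrite lt_neqAle; apply/andP; split; last first.
  by apply: le_trans (mleadB_le p q) _; rewrite -eqpq joinxx.
apply: contra nz => /eqP h.
by rewrite -mleadc_eq0 h mcoeffB eqc subrr.
Qed.

(** Division works over the integers because both leading coefficients are 1. By induction on the
    leading monomial of [g], the leading term is cancelled by a multiple of [d] or [e], or else
    moved to the remainder. *)
Lemma mlead_division2 (n : nat) (d e : {mpoly int[n]}) :
  d@_(mlead d) = 1 -> e@_(mlead e) = 1 -> forall g : {mpoly int[n]},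
  exists a b r : {mpoly int[n]}, g = a * d + b * e + r /\
    forall m, m \in msupp r -> ~~ (mlead d <= m)%MM && ~~ (mlead e <= m)%MM.
Proof.
move=> lcd lce; elim/mleadrect => g IH.
have [->|nzg] := eqVneq g 0.
  by exists 0, 0, 0; rewrite !mul0r !addr0; split=> // m; rewrite msupp0.
have nz (f : {mpoly int[n]}) : f@_(mlead f) = 1 -> f != 0.
  by move=> h; rewrite -mleadc_eq0 h.
have nzc : g@_(mlead g) != 0 by rewrite mleadc_eq0.
(* [t * f] has the leading term of [g], so subtracting it lowers the leading monomial. *)
have step (f : {mpoly int[n]}) : f@_(mlead f) = 1 -> (mlead f <= mlead g)%MM ->
    let t := g@_(mlead g) *: 'X_[(mlead g - mlead f)%MM] in
    let h := g - t * f in h = 0 \/ (mlead h < mlead g)%O.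
  move=> lcf fg t h; have [->|nzh] := eqVneq h 0; [by left | right].
  have nzt : t != 0.
    by rewrite /t -msupp_eq0 msuppMCX.
  have lt : mlead t = (mlead g - mlead f)%MM by rewrite mleadZ // mleadXm.
  have ltf : mlead (t * f) = mlead g.
    by rewrite (mleadM nzt (nz _ lcf)) lt submK.
  apply: ltm_mlead_sub => //.
  rewrite -[in RHS]ltf (mleadM nzt (nz _ lcf)) mleadcM lcf mulr1.
  by rewrite lt /t mcoeffZ mcoeffX eqxx mulr1.
have [dg|ndg] := boolP (mlead d <= mlead g)%MM.
  have := step d lcd dg; set t := _ *: _ => /= -[h0|/IH].
    exists t, 0, 0; rewrite mul0r !addr0; split; last by move=> m; rewrite msupp0.
    exact: subr0_eq.
  case=> a [b [r [eqh Hr]]]; exists (t + a), b, r; split=> //.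
  by rewrite mulrDl -!addrA [a * d + _]addrA -eqh addrC subrK.
have [eg|neg] := boolP (mlead e <= mlead g)%MM.
  have := step e lce eg; set t := _ *: _ => /= -[h0|/IH].
    exists 0, t, 0; rewrite mul0r add0r !addr0; split; last by move=> m; rewrite msupp0.
    exact: subr0_eq.
  case=> a [b [r [eqh Hr]]]; exists a, (t + b), r; split=> //.
  by rewrite mulrDl addrCA -!addrA [a * d + _]addrA -eqh addrC subrK.
(* Neither leading monomial divides that of [g]: the leading term joins the remainder. *)
pose t := g@_(mlead g) *: 'X_[mlead g] : {mpoly int[n]}.
have supt m : m \in msupp t -> m = mlead g.
  by move/msuppZ_le; rewrite msuppX inE => /eqP.
have [h0|nzh] := eqVneq (g - t) 0.
  exists 0, 0, t; rewrite !mul0r !add0r; split.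
    exact: subr0_eq.
  by move=> m /supt ->; rewrite ndg neg.
have /IH [a [b [r [eqh Hr]]]] : (mlead (g - t) < mlead g)%O by exact: ltm_mleadD.
exists a, b, (r + t); split; first by rewrite addrA -eqh subrK.
by move=> m /msuppD_le; rewrite mem_cat => /orP[/Hr//|/supt ->]; rewrite ndg neg.
Qed.

Definition mcoprime (n : nat) (a b : 'X_{1..n}) := forall i, a i = 0%N \/ b i = 0%N.

Lemma mcoprime_lem_add (n : nat) (a b c : 'X_{1..n}) :
  mcoprime a b -> (a <= c + b)%MM -> (a <= c)%MM.
Proof.
move=> ab /mnm_lepP h; apply/mnm_lepP => i; have := h i; rewrite mnmDE.
by case: (ab i) => ->; rewrite ?addn0.
Qed.

Lemma mlead_add_neq (n : nat) (p q : {mpoly int[n]}) :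
  (p != 0 -> q != 0 -> mlead p != mlead q) -> p + q != 0 ->
  (p != 0 /\ mlead (p + q) = mlead p) \/ (q != 0 /\ mlead (p + q) = mlead q).
Proof.
have [->|nzp] := eqVneq p 0; first by rewrite add0r; right.
have [->|nzq] := eqVneq q 0; first by rewrite addr0; left.
move=> /(_ isT isT) /mleadD -> _; case: leP => _; by [right | left].
Qed.

(* Reducing the cofactors first makes the three products have pairwise distinct
   leading monomials, so no cancellation can occur. *)
Lemma mlead_coprime3 (n : nat) (d1 d2 d3 g1 g2 g3 : {mpoly int[n]}) :
  d1@_(mlead d1) = 1 -> d2@_(mlead d2) = 1 -> d3@_(mlead d3) = 1 ->
  mcoprime (mlead d2) (mlead d1) -> mcoprime (mlead d3) (mlead d1) ->
  mcoprime (mlead d3) (mlead d2) ->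
  let f := g1 * d1 + g2 * d2 + g3 * d3 in f != 0 ->
  [\/ (mlead d1 <= mlead f)%MM, (mlead d2 <= mlead f)%MM |
      (mlead d3 <= mlead f)%MM].
Proof.
move=> lc1 lc2 lc3 c21 c31 c32.
have [a [b [r1 [-> H1]]]] := mlead_division2 lc2 lc3 g1.
(* The quotient [a] moves to the cofactor of [d2] before that is reduced. Listing [d3] twice gives a
   division by [d3] alone; the remaining quotients are collected in [h3]. *)
have [a' [b' [r2 [eq2 H2]]]] := mlead_division2 lc3 lc3 (g2 + a * d1).
set h3 := g3 + b * d1 + (a' + b') * d2.
have -> : (a * d2 + b * d3 + r1) * d1 + g2 * d2 + g3 * d3
        = r1 * d1 + (r2 * d2 + h3 * d3).
  have -> : g2 = a' * d3 + b' * d3 + r2 - a * d1 by rewrite -eq2 addrK.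
  by rewrite /h3; ring.
move=> f nzf.
have nz (h : {mpoly int[n]}) : h@_(mlead h) = 1 -> h != 0.
  by move=> e; rewrite -mleadc_eq0 e.
have nzl (p q : {mpoly int[n]}) : p * q != 0 -> p != 0.
  by apply: contra => /eqP->; rewrite mul0r.
have [z1 z2 z3] := And3 (nz _ lc1) (nz _ lc2) (nz _ lc3).
(* If both products had the same leading monomial, that of [d3], being coprime to that of [d2],
   would divide a monomial of the reduced [r2]. *)
have tail23 : r2 * d2 + h3 * d3 != 0 ->
   (r2 * d2 != 0 /\ mlead (r2 * d2 + h3 * d3) = mlead (r2 * d2)) \/
   (h3 * d3 != 0 /\ mlead (r2 * d2 + h3 * d3) = mlead (h3 * d3)).
  apply: mlead_add_neq => /nzl nr2 /nzl nh3; rewrite !mleadM //.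
  apply/negP => /eqP E; have /H2/andP[/negP[]] := mlead_supp nr2.
  by apply: mcoprime_lem_add c32 _; rewrite E; apply/mnm_lepP => i; rewrite mnmDE leq_addl.
have n1 : r1 * d1 != 0 -> r2 * d2 + h3 * d3 != 0 ->
    mlead (r1 * d1) != mlead (r2 * d2 + h3 * d3).
  move=> /nzl nr1 /tail23; have /H1/andP[/negP k2 /negP k3] := mlead_supp nr1.
  case=> -[] /nzl n2 ->; rewrite !mleadM //; apply/negP => /eqP E.
    by apply/k2/(mcoprime_lem_add c21); rewrite E; apply/mnm_lepP => i; rewrite mnmDE leq_addl.
  by apply/k3/(mcoprime_lem_add c31); rewrite E; apply/mnm_lepP => i; rewrite mnmDE leq_addl.
have dv (p q : {mpoly int[n]}) : q != 0 -> p * q != 0 -> (mlead q <= mlead (p * q))%MM.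
  by move=> nq /nzl np; rewrite mleadM //; apply/mnm_lepP => i; rewrite mnmDE leq_addl.
case: (mlead_add_neq n1 nzf) => -[k1 E]; rewrite /f E.
  by apply: Or31; exact: dv.
case: (tail23 k1) => -[k E']; rewrite E'; [apply: Or32 | apply: Or33]; exact: dv.
Qed.

(** * Branches of a tree *)

Definition avoiding (n : nat) (adj : rel 'I_n) (v : 'I_n) : rel 'I_n :=
  [rel p q | [&& adj p q, p != v & q != v]].

(** For a neighbour [a] of [v] this is the component of T - v containing [a]. *)
Definition branch (n : nat) (adj : rel 'I_n) (v a : 'I_n) : {set 'I_n} :=
  [set x | connect (avoiding adj v) a x].

Lemma tree_sym (n : nat) (adj : rel 'I_n) u v : is_tree adj -> adj u v = adj v u.
Proof. by case. Qed.

Lemma tree_neq (n : nat) (adj : rel 'I_n) u v : is_tree adj -> adj u v -> u != v.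
Proof. by case=> _ _ irr _ _; apply: contraTneq => ->; rewrite irr. Qed.

Lemma avoiding_sym (n : nat) (adj : rel 'I_n) v :
  is_tree adj -> connect_sym (avoiding adj v).
Proof.
move=> tT; apply: sym_connect_sym => x y; rewrite /avoiding /=.
by rewrite (tree_sym _ _ tT) [(x != v) && _]andbC.
Qed.

Lemma branch_root (n : nat) (adj : rel 'I_n) v a : a \in branch adj v a.
Proof. by rewrite inE. Qed.

Lemma branch_closed (n : nat) (adj : rel 'I_n) v a p q : is_tree adj ->
  p != v -> q != v -> adj p q -> (p \in branch adj v a) = (q \in branch adj v a).
Proof.
move=> tT pv qv pq; rewrite !inE; apply: same_connect_r; first exact: avoiding_sym.
by apply: connect1; rewrite /avoiding /= pq pv qv.
Qed.

Lemma branch_notin (n : nat) (adj : rel 'I_n) v a : is_tree adj -> adj v a ->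
  v \notin branch adj v a.
Proof.
move=> tT va; have av : a != v by rewrite eq_sym (tree_neq tT va).
rewrite inE; apply/negP => /connectP[s /[swap]].
case/lastP: s => [/= e|s y]; first by rewrite e eqxx in av.
rewrite last_rcons => <-; rewrite rcons_path => /andP[_].
by rewrite /avoiding /= eqxx !andbF.
Qed.

(** A path from [a] to a different [p] that avoids [v] would close up through [v] to a cycle. *)
Lemma branch_exit (n : nat) (adj : rel 'I_n) v a p : is_tree adj -> adj v a ->
  p \in branch adj v a -> adj p v -> p = a.
Proof.
move=> tT va + pv; rewrite inE => /connectP[s sp ep].
apply/eqP; apply: contraT => pa; case: (tT) => _ _ _ _ []; move: ep.
case/shortenP: sp => s' sp us _ ep; exists v, (a :: s'); split.
- by case: s' ep {sp us} => // e; rewrite e eqxx in pa.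
- rewrite cons_uniq us andbT inE negb_or (tree_neq tT va) /=.
  have al : all [pred x | x != v] s'.
    elim: s' a sp {va us ep pa} => //= y s' IH a.
    by case/andP=> /and3P[_ _ ->] /IH.
  by apply/negP => /(allP al) /=; rewrite eqxx.
- rewrite /= va /=; apply: sub_path sp => x y; by case/andP.
- by rewrite /= -ep.
Qed.

(** The second vertex of a simple path from [v] to [x] serves as [a]: the rest of the path avoids
    [v]. *)
Lemma branch_cover (n : nat) (adj : rel 'I_n) v x : is_tree adj -> x != v ->
  exists2 a, adj v a & x \in branch adj v a.
Proof.
move=> tT xv; have /connectP[s sp ex] : connect adj v x by case: tT => _ _ _ ->.
case/shortenP: sp ex => [[|a s']] sp us _ ex; first by rewrite ex eqxx in xv.
move: sp us => /= /andP[va sp] /andP[vas _]; exists a => //.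
rewrite inE; apply/connectP; exists s' => //=.
move: vas sp; rewrite inE negb_or {ex va}.
rewrite eq_sym; elim: s' a => //= y s' IH a /andP[av]; rewrite inE negb_or => /andP[vy vs].
by case/andP=> ay sp; rewrite /avoiding /= ay av (eq_sym y) vy IH // eq_sym vy.
Qed.

Lemma branch_uniq (n : nat) (adj : rel 'I_n) v a b x : is_tree adj ->
  adj v a -> adj v b -> x \in branch adj v a -> x \in branch adj v b -> a = b.
Proof.
move=> tT va vb; rewrite !inE => ax bx.
apply/esym; apply: (branch_exit tT va); last by rewrite (tree_sym _ _ tT).
by rewrite inE; apply: connect_trans ax _; rewrite (avoiding_sym v tT).
Qed.

(** These are the two sides of the edge [va]: by [branch_exit] no other edge joins them, and every
    vertex off the branch of [a] is [v] or lies in another branch at [v]. *)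
Lemma branch_compl (n : nat) (adj : rel 'I_n) v a : is_tree adj -> adj v a ->
  branch adj a v = ~: branch adj v a.
Proof.
move=> tT va; have av : adj a v by rewrite (tree_sym _ _ tT).
apply/setP => x; rewrite [RHS]inE; apply/idP/idP => [xv|xa].
  apply/negP => xa; have : v \in branch adj v a; last exact/negP/branch_notin.
  have cl : closed (avoiding adj a) (branch adj v a).
    apply: intro_closed; first exact: avoiding_sym.
    move=> p q /and3P[pq pa qa] pin.
    have pv : p != v by apply: contraTneq pin => ->; exact: branch_notin.
    rewrite -(branch_closed _ tT pv _ pq) //.
    apply: contraNneq pa => qv; apply/eqP/(branch_exit tT va pin).
    by rewrite -qv.
  by rewrite (closed_connect cl (y := x)) //; move: xv; rewrite inE.
have [->|xv] := eqVneq x v; first exact: branch_root.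
have [b vb xb] := branch_cover tT xv.
have ba : b != a by apply: contraNneq xa => <-.
have nab : a \notin branch adj v b.
  by apply: contra ba => h; apply/eqP/esym/(branch_exit tT vb h).
have vb' : v != a by exact: tree_neq tT va.
have bin : b \in branch adj a v.
  by rewrite inE; apply: connect1; rewrite /avoiding /= vb vb' ba.
(* Steps inside the branch of [b] never meet [a], so all of it is reachable from [v] without [a]. *)
have cl : closed (avoiding adj v) (branch adj v b :&: branch adj a v).
  apply: intro_closed; first exact: avoiding_sym.
  move=> p q /and3P[pq pv qv]; rewrite !in_setI => /andP[pb pin].
  have qb : q \in branch adj v b by rewrite -(branch_closed _ tT pv qv pq).
  rewrite qb -(branch_closed _ tT _ _ pq) //; first by apply: contraNneq nab => <-.
  by apply: contraNneq nab => <-.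
move: xb; rewrite inE => /(closed_connect cl).
by rewrite !in_setI branch_root bin => /esym/andP[].
Qed.

(** * Block determinants and minors *)

(** Padding by the identity makes the principal minor on [B] an [n] by [n] determinant, with the
    vertices still serving as indices. *)
Definition principal_mx (R : comNzRingType) (n : nat) (B : {set 'I_n}) (A : 'M[R]_n) :=
  \matrix_(i, j) if i \in B then if j \in B then A i j else 0 else (i == j)%:R.

Definition replace_col (R : comNzRingType) (n : nat) (w : 'I_n) (c : 'I_n -> R)
  (A : 'M[R]_n) := \matrix_(i, j) if j == w then c i else A i j.

(** Block triangularity without reordering indices: [A] is a product whose right factor is
    [principal_mx B A] and whose left factor is [A] with the columns in [B] replaced by identity
    columns. *)
Lemma det_principal_dvd (R : comNzRingType) (n : nat) (B : {set 'I_n}) (A : 'M[R]_n) :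
  (forall i j, i \notin B -> j \in B -> A i j = 0) ->
  exists q, \det A = q * \det (principal_mx B A).
Proof.
move=> A0.
exists (\det (\matrix_(i, j) if j \in B then (i == j)%:R else A i j)).
rewrite -det_mulmx; congr (\det _); apply/matrixP => i j; rewrite !mxE.
have [jB|jB] := boolP (j \in B); last first.
  rewrite (bigD1 j) //= !mxE (negbTE jB) eqxx mulr1 big1 ?addr0 // => k kj.
  by rewrite !mxE (negbTE jB) (negbTE kj); case: ifP; rewrite mulr0.
have [iB|iB] := boolP (i \in B).
  rewrite (bigD1 i) //= !mxE iB jB eqxx mul1r big1 ?addr0 // => k ki.
  rewrite !mxE jB; case: ifP => kB; first by rewrite eq_sym (negbTE ki) mul0r.
  by rewrite (_ : k == j = false) ?mulr0 //; apply: contraFF kB => /eqP->.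
rewrite A0 // big1 // => k _; rewrite !mxE jB; case: ifP => kB.
  by rewrite (_ : i == k = false) ?mul0r //; apply: contraNF iB => /eqP->.
by rewrite (_ : k == j = false) ?mulr0 //; apply: contraFF kB => /eqP->.
Qed.

(* Row v is split into its part supported on B and the rest: each of the two
   resulting determinants is block triangular. *)
Lemma det_replace_col_two_blocks (R : comNzRingType) (n : nat) (A : 'M[R]_n)
    (B B' : {set 'I_n}) (v w : 'I_n) (c : 'I_n -> R) :
  [disjoint B & B'] -> v \notin B -> v \notin B' -> w \notin B -> w \notin B' ->
  (forall i j, i != v -> i \notin B -> j \in B -> A i j = 0) ->
  (forall i j, i != v -> i \notin B' -> j \in B' -> A i j = 0) ->
  exists q q', \det (replace_col w c A) =
    q * \det (principal_mx B A) + q' * \det (principal_mx B' A).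
Proof.
move=> dB vB vB' wB wB' A0 A0'; set M := replace_col w c A.
pose M1 : 'M_n := \matrix_(i, j) if (i == v) && (j \in B) then 0 else M i j.
pose M2 : 'M_n := \matrix_(i, j) if (i == v) && (j \notin B) then 0 else M i j.
have neq (x y : 'I_n) (D : {set 'I_n}) : x \in D -> y \notin D -> x == y = false.
  by move=> xD yD; apply: contraNF yD => /eqP<-.
have [q eq1] : exists q, \det M1 = q * \det (principal_mx B M1).
  apply: det_principal_dvd => i j iB jB; rewrite !mxE jB andbT.
  by case: ifPn => // iv; rewrite (neq j w B) // A0.
have [q' eq2] : exists q, \det M2 = q * \det (principal_mx B' M2).
  apply: det_principal_dvd => i j iB jB; rewrite !mxE.
  have -> /= : j \notin B by rewrite (disjointFl dB jB).
  by case: ifPn => //; rewrite andbT => iv; rewrite (neq j w B') // A0'.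
have -> : principal_mx B A = principal_mx B M1.
  apply/matrixP => i j; rewrite !mxE; case: ifP => // iB; case: ifP => // jB.
  by rewrite (neq i v B) // (neq j w B).
have -> : principal_mx B' A = principal_mx B' M2.
  apply/matrixP => i j; rewrite !mxE; case: ifP => // iB; case: ifP => // jB.
  by rewrite (neq i v B') // (neq j w B').
exists q, q'; rewrite -eq1 -eq2 -[\det M1]mul1r -[\det M2]mul1r.
apply: (determinant_multilinear (i0 := v)).
- apply/rowP => j; rewrite !mxE eqxx /=.
  by case: (j \in B); rewrite /= ?mulr0 ?mul1r ?add0r ?addr0.
- by apply/matrixP => i j; rewrite !mxE eq_sym (negbTE (neq_lift _ _)).
- by apply/matrixP => i j; rewrite !mxE eq_sym (negbTE (neq_lift _ _)).
Qed.

(** Expansion along column [w]; it lets permutations of all vertices be used for a minor of size n -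
    1. *)
Lemma det_replace_delta_col (R : comNzRingType) (n : nat) (A : 'M[R]_n) (u w : 'I_n) :
  \det (replace_col w (fun i => (i == u)%:R) A) = cofactor A u w.
Proof.
rewrite (expand_det_col _ w) (bigD1 u) //= big1 ?addr0.
  rewrite mxE !eqxx mul1r /cofactor; congr (_ * \det _).
  by apply/matrixP => i j; rewrite !mxE eq_sym (negbTE (neq_lift _ _)).
by move=> i iu; rewrite mxE eqxx (negbTE iu) mul0r.
Qed.

(** * Index maps of minors of size n - 1 *)

Lemma strictly_increasing_inj (k n : nat) (f : 'I_k -> 'I_n) :
  strictly_increasing f -> injective f.
Proof.
move=> fi x y e; apply/val_inj/eqP; case: ltngtP => // /fi; by rewrite e ltnn.
Qed.

(** Both maps list the same image in increasing order, and such a list is unique. *)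
Lemma strictly_increasing_eq (k n : nat) (f g : 'I_k -> 'I_n) :
  strictly_increasing f -> strictly_increasing g ->
  [set f i | i in 'I_k] = [set g i | i in 'I_k] -> f =1 g.
Proof.
move=> fi gi fg.
have srt (h : 'I_k -> 'I_n) : strictly_increasing h ->
    sorted (fun a b : 'I_n => (a < b)%N) [seq h i | i <- enum 'I_k].
  move=> hi; rewrite sorted_map.
  have : sorted (relpre val ltn) (enum 'I_k).
    by rewrite -sorted_map val_enum_ord iota_ltn_sorted.
  by apply: sub_sorted => a b; exact: hi.
have E : [seq f i | i <- enum 'I_k] = [seq g i | i <- enum 'I_k].
  apply: (irr_sorted_eq _ _ (srt _ fi) (srt _ gi)).
  - by move=> a b c; exact: ltn_trans.
  - by move=> a; exact: ltnn.
  move=> x; have := congr1 (fun D : {set 'I_n} => x \in D) fg => /= fgx.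
  have mem (h : 'I_k -> 'I_n) : (x \in [seq h i | i <- enum 'I_k]) = (x \in [set h i | i in 'I_k]).
    apply/mapP/imsetP => [[i _ ->]|[i _ ->]]; exists i => //; exact: mem_enum.
  by rewrite !mem.
by move=> i; have /eq_in_map := E; apply; rewrite mem_enum.
Qed.

Lemma lift_strictly_increasing (n : nat) (u : 'I_n.+1) :
  strictly_increasing (lift u).
Proof.
move=> a b ab; rewrite /= /bump; case: (leqP u a) => ua; case: (leqP u b) => ub //.
  by rewrite ltnNge (leq_trans ua) // ltnW // (leq_trans ab) // ltnW in ub.
by rewrite add1n ltnS ltnW.
Qed.

Lemma lift_image (n : nat) (u : 'I_n.+1) : [set lift u i | i in 'I_n] = [set~ u].
Proof.
apply/setP => x; rewrite !inE; apply/imsetP/idP => [[i _ ->]|].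
  by rewrite eq_sym neq_lift.
by rewrite eq_sym => /unlift_some[j -> _]; exists j.
Qed.

(** The image misses exactly one index, which is [u]. *)
Lemma strictly_increasing_lift (n : nat) (f : 'I_n -> 'I_n.+1) :
  strictly_increasing f -> exists u : 'I_n.+1, f =1 lift u.
Proof.
move=> fi; have cf := card_imset predT (strictly_increasing_inj fi).
have : #|~: [set f i | i in 'I_n]| == 1%N.
  by rewrite cardsCs setCK card_ord cf card_ord subSnn.
case/cards1P => u eu; exists u.
apply: strictly_increasing_eq => //; first exact: lift_strictly_increasing.
by rewrite lift_image -eu setCK.
Qed.

Lemma minor_lift (R : comNzRingType) (n : nat) (A : 'M[R]_n.+1) (f g : 'I_n -> 'I_n.+1)
    (u w : 'I_n.+1) :
  f =1 lift u -> g =1 lift w ->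
  \det (mxsub f g A) = (-1) ^+ (u + w) * cofactor A u w.
Proof.
move=> fu gw; rewrite /cofactor mulrA -exprD addnn -muln2 mulnC exprM sqrrN !expr1n mul1r.
by congr (\det _); apply/matrixP => i j; rewrite !mxE fu gw.
Qed.

(* The index type is kept abstract because #|M| = n.-1 is only propositional. *)
Lemma minor_cofactor (R : comNzRingType) (n k : nat) (A : 'M[R]_n) (f g : 'I_k -> 'I_n) :
  (0 < n)%N -> k = n.-1 -> strictly_increasing f -> strictly_increasing g ->
  exists u w, [/\ [set f i | i in 'I_k] = [set~ u], [set g i | i in 'I_k] = [set~ w] &
   \det (mxsub f g A) = (-1) ^+ (u + w) * cofactor A u w].
Proof.
case: n A f g => // n A f g _ /= ek; move: f g; rewrite ek => f g fi gi.
have [u fu] := strictly_increasing_lift fi; have [w gw] := strictly_increasing_lift gi.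
exists u, w; split; [| |exact: minor_lift].
  by rewrite -lift_image; apply: eq_imset.
by rewrite -lift_image; apply: eq_imset.
Qed.

Lemma enum_setC1 (n k : nat) (u : 'I_n) : k = n.-1 ->
  exists2 f : 'I_k -> 'I_n, strictly_increasing f & [set f i | i in 'I_k] = [set~ u].
Proof.
case: n u => [[]//|n] u /= ek; rewrite ek; exists (lift u).
  exact: lift_strictly_increasing.
exact: lift_image.
Qed.

(** * Leading monomials of principal minors *)

Definition mset (n : nat) (B : {set 'I_n}) : 'X_{1..n} := [multinom (i \in B : nat) | i < n].

Lemma mset_lem (n : nat) (B C : {set 'I_n}) : (mset B <= mset C)%MM = (B \subset C).
Proof.
apply/mnm_lepP/subsetP => [h i iB|h i].
  by have := h i; rewrite !mnmE iB; case: (i \in C).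
by rewrite !mnmE; case: (boolP (i \in B)) => // /h ->.
Qed.

Definition principal_det (n : nat) (adj : rel 'I_n) (B : {set 'I_n}) : {mpoly int[n]} :=
  \det (principal_mx B (gen_laplacian adj)).

(** Variables occur only on the diagonal inside [B], so a Leibniz term is an integer times the
    squarefree monomial of the fixed points of [s] in [B]. *)
Lemma principal_prodE (n : nat) (adj : rel 'I_n) (B : {set 'I_n}) (s : 'S_n) :
  let C i j : int := if i \in B then if j \in B then if i == j then 1 else
      if adj i j then -1 else 0 else 0 else (i == j)%:R in
  \prod_i principal_mx B (gen_laplacian adj) i (s i) =
  (\prod_i C i (s i)) *: 'X_[mset [set i in B | s i == i]].
Proof.
move=> C.
pose e i : 'X_{1..n} := if (i \in B) && (s i == i) then U_(i)%MM else 0%MM.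
have -> : mset [set i in B | s i == i] = (\big[+%MM/0%MM]_i e i)%MM.
  apply/mnmP => j; rewrite mnm_sumE mnmE inE (bigD1 j) //= big1 ?addn0.
    by rewrite /e; case: ifP; rewrite ?mnm1E ?eqxx ?mnm0E.
  move=> i ij; rewrite /e; case: ifP => _; last by rewrite mnm0E.
  by rewrite mnm1E (negbTE ij).
rewrite -mprodXE -scaler_prod; apply: eq_bigr => i _; rewrite !mxE /C /e.
case: (boolP (i \in B)) => iB /=; last first.
  by rewrite mpolyX0; case: (i == s i); rewrite ?scale1r ?scale0r.
have [<-|nis] := eqVneq i (s i); first by rewrite iB scale1r.
rewrite mpolyX0; case: (s i \in B); rewrite ?scale0r //.
by case: (adj _ _); rewrite ?scale0r // scaleN1r.
Qed.

(** Only permutations fixing [B] pointwise yield this monomial, and one that moves a point outside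
    [B] meets a zero of the identity block. The identity permutation remains. *)
Lemma principal_det_coef (n : nat) (adj : rel 'I_n) (B : {set 'I_n}) :
  (principal_det adj B)@_(mset B) = 1.
Proof.
rewrite /principal_det /determinant raddf_sum (bigD1 1%g) //= odd_perm1 expr0 mul1r.
rewrite principal_prodE big1 => [|i _]; last first.
  by rewrite perm1 eqxx; case: (i \in B).
rewrite scale1r mcoeffX (_ : mset _ = mset B) ?eqxx; last first.
  by congr mset; apply/setP => i; rewrite inE perm1 eqxx andbT.
rewrite big1 ?addr0 // => s s1; rewrite principal_prodE mulr_sign.
set c := \prod_i _; suff : (c *: 'X_[mset [set i in B | s i == i]])@_(mset B) = 0 :> int.
  by case: (odd_perm s) => // h; rewrite mcoeffN h oppr0.
rewrite mcoeffZ mcoeffX; have [/eqP|_] := eqVneq; last by rewrite mulr0.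
rewrite eq_sym => /eqP eqB.
have /existsP[i si] : [exists i, s i != i].
  apply: contraR s1; rewrite negb_exists => /forallP h.
  by apply/eqP/permP => i; rewrite perm1; apply/eqP/negPn/h.
have iB : i \notin B.
  apply: contra si => iB; have : B \subset [set i in B | s i == i].
    by rewrite -mset_lem -eqB lepm_refl.
  by move/subsetP/(_ i iB); rewrite inE => /andP[].
by rewrite /c (bigD1 i) //= (negbTE iB) eq_sym (negbTE si) !mul0r.
Qed.

Lemma msupp_principal_det (n : nat) (adj : rel 'I_n) (B : {set 'I_n}) m :
  m \in msupp (principal_det adj B) -> (m <= mset B)%MM.
Proof.
rewrite mcoeff_msupp; apply: contraR => nm.
rewrite /principal_det /determinant raddf_sum big1 //= => s _.
rewrite principal_prodE mulr_sign.
set c := \prod_i _; suff : (c *: 'X_[mset [set i in B | s i == i]])@_m = 0 :> int.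
  by case: (odd_perm s) => // h; rewrite mcoeffN h oppr0.
rewrite mcoeffZ mcoeffX; have [e|_] := eqVneq; last by rewrite mulr0.
move: nm; rewrite -e mset_lem; case/negP.
by apply/subsetP => i; rewrite inE => /andP[].
Qed.

Lemma principal_det_neq0 (n : nat) (adj : rel 'I_n) (B : {set 'I_n}) :
  principal_det adj B != 0.
Proof. by apply/eqP => e; have := principal_det_coef adj B; rewrite e mcoeff0. Qed.

Lemma mlead_principal_det (n : nat) (adj : rel 'I_n) (B : {set 'I_n}) :
  mlead (principal_det adj B) = mset B.
Proof.
apply/le_anti/andP; split.
  exact/lem_leo/msupp_principal_det/mlead_supp/principal_det_neq0.
by apply: msupp_le_mlead; rewrite mcoeff_msupp principal_det_coef.
Qed.

(** * The minor of an oriented 2-matching *)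

Definition loop_vertices (n : nat) (M : {set {set 'I_n}}) : {set 'I_n} :=
  [set v | [set v] \in M].

Lemma is_loop_set2 (n : nat) (a b : 'I_n) : is_loop [set a; b] = (a == b).
Proof. by rewrite /is_loop cards2; case: (a == b). Qed.

Lemma set2_inj (T : finType) (a b c d : T) : a != b ->
  [set a; b] = [set c; d] -> (a = c /\ b = d) \/ (a = d /\ b = c).
Proof.
move=> ab e; have : a \in [set c; d] by rewrite -e set21.
have : b \in [set c; d] by rewrite -e set22.
rewrite !inE => /orP[]/eqP eb /orP[]/eqP ea; subst; auto; by rewrite eqxx in ab.
Qed.

Lemma two_matching_adj (n : nat) (adj : rel 'I_n) M a b : is_tree adj ->
  two_matching adj M -> a != b -> [set a; b] \in M -> adj a b.
Proof.
move=> tT [ME _] ab /ME [[u eu]|[u [v [uv /(set2_inj ab)]]]].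
  by have := is_loop_set2 a b; rewrite eu /is_loop cards1 (negbTE ab).
by case=> -[-> ->] //; rewrite (tree_sym _ _ tT).
Qed.

(** A loop alone already uses up the incidence 2. *)
Lemma two_matching_loop_edge (n : nat) (adj : rel 'I_n) M a b :
  two_matching adj M -> a != b -> [set a; b] \in M -> a \notin loop_vertices M.
Proof.
case=> _ inc ab eM; rewrite inE; apply/negP => aM.
have := inc a; rewrite /incidence.
set E := [set e in M | _ && _]; set L := [set e in M | _ == _].
have : (0 < #|E|)%N.
  by apply/card_gt0P; exists [set a; b]; rewrite inE eM set21 is_loop_set2.
have : (0 < #|L|)%N by apply/card_gt0P; exists [set a]; rewrite inE aM eqxx.
lia.
Qed.

Lemma orientation_asym (n : nat) (M : {set {set 'I_n}}) D a b :
  orientation M D -> D a b -> ~~ D b a.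
Proof.
case=> DM MD _ _ ab; have [nab abM] := DM _ _ ab.
have [|u [v [e]]] := MD _ abM; first by rewrite is_loop_set2.
case: (set2_inj nab e) => -[<- <-]; rewrite ab /=; by case: (D b a).
Qed.

Lemma card_le1_eq (T : finType) (P : pred T) x y :
  (#|[set z | P z]| <= 1)%N -> P x -> P y -> x = y.
Proof. by move/card_le1_eqP => h px py; apply: h; rewrite inE. Qed.

(** Choosing predecessors is injective on the finite set [S] because successors are unique; hence it
    permutes [S]. *)
Lemma pred_closed_succ (T : finType) (E : rel T) (S : {set T}) :
  (forall y x x', E y x -> E y x' -> x = x') ->
  (forall x, x \in S -> exists2 y, y \in S & E y x) ->
  forall y, y \in S -> exists2 x, x \in S & E y x.
Proof.
move=> Ei Ep; pose f x := odflt x [pick y in S | E y x].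
have fP x : x \in S -> f x \in S /\ E (f x) x.
  move=> xS; rewrite /f; case: pickP => [y /andP[]//|h].
  by have [y yS yx] := Ep x xS; have := h y; rewrite /= yS yx.
have fi : {in S &, injective f}.
  move=> x x' /fP[_ h] /fP[_ h'] e; apply: Ei h _; by rewrite e.
have fS : f @: S = S.
  apply/eqP; rewrite eqEcard card_in_imset // leqnn andbT.
  by apply/subsetP => y /imsetP[x /fP[h _] ->].
move=> y; rewrite -{1}fS => /imsetP[x xS ->]; exists x => //.
by case: (fP x xS).
Qed.

(* Otherwise taking E-predecessors would permute the unlooped vertices of the
   component, so that a would also have a successor inside it. *)
Lemma source_in_branch (n : nat) (adj E : rel 'I_n) (Lv : {set 'I_n}) u a b :
  is_tree adj ->
  (forall x y, E x y -> [/\ adj x y, ~~ E y x, x \notin Lv & y \notin Lv]) ->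
  (forall y x x', E y x -> E y x' -> x = x') ->
  (forall x, x != u -> x \in Lv \/ exists y, E y x) ->
  E a b -> u \in branch adj b a.
Proof.
move=> tT EP Ei Eu ab; have [adjab nba aL bL] := EP _ _ ab.
have adjba : adj b a by rewrite (tree_sym _ _ tT).
apply: contraT => uC; have bC := branch_notin tT adjba.
have [||x] := @pred_closed_succ _ E (branch adj b a :\: Lv) Ei _ a.
- move=> x /setDP[xC xL]; have [|xL'|[y yx]] := Eu x.
  + by apply: contraTneq xC => ->.
  + by rewrite xL' in xL.
  (* The predecessor [y] stays in the branch: if it were [b], then [x] would be [a], against
     asymmetry. *)
  have [adjyx nxy yL _] := EP _ _ yx; exists y => //; rewrite in_setD yL /=.
  have xb : x != b by apply: contraTneq xC => ->.
  rewrite (branch_closed _ tT _ xb adjyx) //; apply: contraNneq nba => yb.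
  by move: (yx); rewrite yb -(branch_exit tT adjba xC) // (tree_sym _ _ tT) -yb.
- by rewrite in_setD aL branch_root.
move=> /setDP[xC _] ax; by rewrite (Ei _ _ _ ax ab) (negbTE bC) in xC.
Qed.

(** In a nonzero Leibniz term the entries in unlooped rows are forced, and their product is a sign.
    The looped rows and columns left over carry the principal minor. *)
Lemma cofactor_matching (n : nat) (adj : rel 'I_n) (M : {set {set 'I_n}}) (D : rel 'I_n) u w :
  is_tree adj -> two_matching adj M -> orientation M D ->
  heads M D = [set~ u] -> tails M D = [set~ w] ->
  exists b : bool, cofactor (gen_laplacian adj) u w =
    (-1) ^+ b * principal_det adj (loop_vertices M).
Proof.
move=> tT tM oD hu tw; set L := gen_laplacian adj; set Lv := loop_vertices M.
have DP x y : D x y -> [/\ adj x y, ~~ D y x, x \notin Lv & y \notin Lv].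
  move=> xy; have [nxy xyM] : x != y /\ [set x; y] \in M by case: (oD) => + _ _ _; apply.
  split; [exact: two_matching_adj tM nxy xyM | exact: orientation_asym oD xy | |].
    exact: two_matching_loop_edge tM nxy xyM.
  by apply: (two_matching_loop_edge tM (b := x)); rewrite 1?eq_sym // setUC.
have Dout y x x' : D y x -> D y x' -> x = x'.
  by case: (oD) => _ _ _ /(_ y); exact: card_le1_eq.
have Din y x x' : D x y -> D x' y -> x = x'.
  by case: (oD) => _ _ /(_ y) + _; apply: (@card_le1_eq _ (fun z => D z y)).
have hP x : (x != u) = (x \in Lv) || [exists y, D y x].
  by have := congr1 (fun S : {set _} => x \in S) hu; rewrite !inE.
have tP x : (x != w) = (x \in Lv) || [exists y, D x y].
  by have := congr1 (fun S : {set _} => x \in S) tw; rewrite !inE.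
have hE x : x != u -> x \in Lv \/ exists y, D y x.
  by rewrite hP => /orP[|/existsP]; [left | right].
have tE x : x != w -> x \in Lv \/ exists y, D x y.
  by rewrite tP => /orP[|/existsP]; [left | right].
have uL : u \notin Lv by apply/negP => h; have := hP u; rewrite eqxx h.
have wL : w \notin Lv by apply/negP => h; have := tP w; rewrite eqxx h.
have tailw a b : D a b -> a != w.
  by move=> ab; rewrite tP; apply/orP; right; apply/existsP; exists b.
have headu a b : D a b -> b != u.
  by move=> ab; rewrite hP; apply/orP; right; apply/existsP; exists a.
set R := replace_col w (fun i => (i == u)%:R) L.
have forced (s : 'S_n) : \prod_i R i (s i) != 0 ->
    s u = w /\ forall a b, D a b -> s b = a.
  move=> nz; have nzi i : R i (s i) != 0.
    by apply: contraNneq nz => e; rewrite (bigD1 i) //= e mul0r.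
  have su : s u = w.
    have := nzi ((s^-1)%g w); rewrite permKV mxE eqxx.
    by have [<-|_] := eqVneq ((s^-1)%g w) u; rewrite ?eqxx // permKV.
  split=> // a b ab; have [adjab nba aL bL] := DP _ _ ab.
  have adjba : adj b a by rewrite (tree_sym _ _ tT).
  (* Cutting at [ab] leaves [u], the vertex that is no head, with [a], and [w], the vertex that is
     no tail, with [b]. The second fact is the first for the reversed direction. *)
  have uC : u \in branch adj b a by apply: source_in_branch tT DP Dout hE ab.
  have wC : w \notin branch adj b a.
    rewrite -in_setC -(branch_compl tT adjba).
    apply: (@source_in_branch _ _ (fun x y => D y x) Lv w b a tT) => //.
      by move=> x y /DP[? ? ? ?]; split=> //; rewrite (tree_sym _ _ tT).
  (* As [s] sends [u] across the cut to [w], counting gives a row on the side of [b] sent to a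
     column on the side of [a]. The only nonzero such entry is at [(b, a)]. *)
  have [i iC siC] : exists2 i, i \notin branch adj b a & s i \in branch adj b a.
    apply: NNPP => h; have sub : s @: (~: branch adj b a) \subset ~: branch adj b a.
      apply/subsetP => _ /imsetP[i iC ->]; rewrite inE; apply/negP => siC.
      by apply: h; exists i => //; rewrite inE in iC.
    have /eqP e : s @: (~: branch adj b a) == ~: branch adj b a.
      by rewrite eqEcard sub card_imset ?leqnn //; exact: perm_inj.
    have : w \in ~: branch adj b a by rewrite inE.
    rewrite -e -su => /imsetP[j jC /perm_inj euj].
    by rewrite -euj inE uC in jC.
  have := nzi i; rewrite mxE ifN; last by apply: contraTneq siC => ->.
  rewrite mxE ifN; last by apply: contraTneq siC => <-.
  case: ifP => [adji _|_]; last by rewrite eqxx.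
  have nsb : s i != b by apply: contraTneq siC => ->; exact: branch_notin.
  have ib : i = b.
    by apply/eqP; apply: contraT => ib; rewrite (branch_closed _ tT ib nsb adji) siC in iC.
  by rewrite -ib; apply: (branch_exit tT adjba siC); rewrite -ib (tree_sym _ _ tT).
(* The forced permutation: unlooped vertices other than [u] go to their predecessor. They all have
   one, so the default is not reached. *)
pose f i := if i == u then w else if i \in Lv then i else odflt i [pick a | D a i].
have fu : f u = w by rewrite /f eqxx.
have fL i : i \in Lv -> f i = i.
  by move=> iL; rewrite /f iL; case: eqP => // iu; rewrite -iu iL in uL.
have fD a b : D a b -> f b = a.
  move=> ab; have [_ _ aL bL] := DP _ _ ab.
  rewrite /f (negbTE (headu _ _ ab)) (negbTE bL); case: pickP => [a' a'b|/(_ a)].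
    exact: Din a'b ab.
  by rewrite /= ab.
have fi : injective f.
  have gi i j : i != u -> f i = f j -> i = j.
    have [->|ju] := eqVneq j u.
      rewrite fu => iu; case: (hE i iu) => [iL|[a ai]].
        by rewrite (fL _ iL) => e; rewrite -e iL in wL.
      by rewrite (fD _ _ ai) => e; have := tailw _ _ ai; rewrite e eqxx.
    move=> iu; case: (hE i iu) => [iL|[a ai]]; case: (hE j ju) => [jL|[c cj]].
    - by rewrite !fL.
    - rewrite (fL _ iL) (fD _ _ cj) => e; have [_ _ cL _] := DP _ _ cj.
      by rewrite -e iL in cL.
    - rewrite (fL _ jL) (fD _ _ ai) => e; have [_ _ aL _] := DP _ _ ai.
      by rewrite e jL in aL.
    rewrite (fD _ _ ai) (fD _ _ cj) => e; apply: Dout ai _; by rewrite e.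
  move=> i j e; have [iu|iu] := eqVneq i u; last exact: gi.
  have [ju|ju] := eqVneq j u; first by rewrite iu ju.
  by apply/esym/gi.
pose p := perm fi.
(* The factors are 1 in row [u] and -1 for each oriented edge. *)
pose e0 := \prod_(i | i \notin Lv) R i (p i).
have [b0 eb0] : exists b : bool, e0 = (-1) ^+ b.
  rewrite /e0; apply: (big_ind (fun x => exists b : bool, x = (-1) ^+ b)).
  - by exists false.
  - by move=> _ _ [b ->] [b' ->]; exists (b (+) b'); rewrite signr_addb.
  move=> i iL; have [->|iu] := eqVneq i u.
    by exists false; rewrite mxE permE fu !eqxx.
  case: (hE i iu) => [iL'|[a ai]]; first by rewrite iL' in iL.
  have [adjai _ _ _] := DP _ _ ai; exists true.
  rewrite mxE permE (fD _ _ ai) (negbTE (tailw _ _ ai)) mxE.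
  by rewrite eq_sym (negbTE (tree_neq tT adjai)) (tree_sym _ _ tT) adjai.
(* If [t] fixes the unlooped vertices, the product splits. Otherwise the right side meets an
   off-diagonal zero and the left side vanishes by [forced]. *)
have term (t : 'S_n) : \prod_i R i ((t * p)%g i) =
    e0 * \prod_i principal_mx Lv L i (t i).
  have [/forallP tfix|] := boolP [forall i, (i \notin Lv) ==> (t i == i)].
    rewrite (bigID (fun i => i \in Lv)) /= [in RHS](bigID (fun i => i \in Lv)) /= mulrCA [LHS]mulrC.
    rewrite mulrC; congr (_ * _).
      apply: eq_bigr => i iL; rewrite permM permE.
      have tL : t i \in Lv.
        apply: contraT => tL; have := tfix (t i); rewrite tL => /eqP/perm_inj e.
        by rewrite e iL in tL.
      rewrite (fL _ tL) !mxE iL tL ifN //; by apply: contraNneq wL => <-.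
    rewrite /e0 -[LHS]mulr1; congr (_ * _).
      apply: eq_bigr => i iL; rewrite permM; have := tfix i; rewrite iL => /eqP->//.
    rewrite big1 // => i iL; rewrite mxE (negbTE iL).
    by have := tfix i; rewrite iL => /eqP->; rewrite eqxx.
  rewrite negb_forall => /existsP[i]; rewrite negb_imply => /andP[iL ti].
  rewrite [in RHS](bigD1 i) //= mxE (negbTE iL) eq_sym (negbTE ti) mul0r mulr0.
  apply/eqP; apply: contraT => /forced[sfu sfD]; case/eqP: ti.
  apply: (@perm_inj _ p); rewrite -permM.
  have [->|iu] := eqVneq i u; first by rewrite sfu permE fu.
  case: (hE i iu) => [iL'|[a ai]]; first by rewrite iL' in iL.
  by rewrite (sfD _ _ ai) permE (fD _ _ ai).
exists (odd_perm p (+) b0); rewrite -det_replace_delta_col -/R.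
rewrite /principal_det /determinant (reindex_inj (mulIg p)) /= mulr_sumr.
apply: eq_bigr => t _; rewrite term eb0 odd_permM; move: (odd_perm t) (odd_perm p) => st sp.
by rewrite !signr_addb -!mulrA mulrCA; congr (_ * _); rewrite mulrCA.
Qed.

(** * Existence of orientations and the number of heads and tails *)

Lemma two_matching_sub (n : nat) (adj : rel 'I_n) (M M' : {set {set 'I_n}}) :
  M' \subset M -> two_matching adj M -> two_matching adj M'.
Proof.
move=> /subsetP sub [ME inc]; split=> [e /sub/ME //|v].
apply: leq_trans (inc v); rewrite /incidence leq_add ?leq_mul //.
  by apply: subset_leq_card; apply/subsetP => e; rewrite !inE => /andP[/sub-> ->].
by apply: subset_leq_card; apply/subsetP => e; rewrite !inE => /andP[/sub-> ->].
Qed.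

(** Otherwise three distinct edges would meet at [v]. *)
Lemma two_matching_degree (n : nat) (adj : rel 'I_n) (M : {set {set 'I_n}}) v a b c :
  two_matching adj M -> v != a -> v != b -> v != c ->
  [set v; a] \in M -> [set v; b] \in M -> [set v; c] \in M ->
  a != b -> a != c -> b = c.
Proof.
case=> _ /(_ v) + va vb vc aM bM cM ab ac; apply: contraTeq => bc.
rewrite -ltnNge; apply: (@leq_trans #|[set [set v; a]; [set v; b]; [set v; c]]|).
  have E x y : v != x -> x != y -> [set v; x] != [set v; y].
    move=> vx xy; apply/eqP => /(set2_inj vx)[[_ e]|[_ e]].
      by rewrite e eqxx in xy.
    by rewrite e eqxx in vx.
  by rewrite -setUA cardsU1 cards2 !inE negb_or !E.
rewrite /incidence; apply: leq_trans (leq_addr _ _); apply: subset_leq_card.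
apply/subsetP => e; rewrite !inE => /orP[/orP[]|] /eqP->.
- by rewrite aM set21 is_loop_set2 va.
- by rewrite bM set21 is_loop_set2 vb.
- by rewrite cM set21 is_loop_set2 vc.
Qed.

Lemma orientation_flip (n : nat) (M : {set {set 'I_n}}) (D : rel 'I_n) :
  orientation M D -> orientation M (fun x y => D y x).
Proof.
case=> [DM MD Din Dout]; split=> //.
  by move=> u v /DM[uv uvM]; rewrite eq_sym setUC.
by move=> e eM /(MD e eM)[u [v [-> h]]]; exists u, v; rewrite addbC.
Qed.

(* Removing an edge ab separates the tree into two sides; reversing the
   orientation on a side if necessary makes a a sink and b a source. *)
Lemma orientation_exists (n : nat) (adj : rel 'I_n) (M : {set {set 'I_n}}) :
  is_tree adj -> two_matching adj M -> exists D, orientation M D.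
Proof.
move=> tT; have [k] := ubnP #|[set e in M | ~~ is_loop e]|.
elim: k M => // k IH M lek tM.
have [NM0|/set0Pn[e]] := eqVneq [set e in M | ~~ is_loop e] set0.
  exists (fun _ _ => false); split=> //.
  - move=> e eM el; have : e \in [set e in M | ~~ is_loop e] by rewrite inE eM.
    by rewrite NM0 inE.
  - by move=> v; rewrite (_ : [set _ | _] = set0) ?cards0 //; apply/setP => x; rewrite !inE.
  - by move=> v; rewrite (_ : [set _ | _] = set0) ?cards0 //; apply/setP => x; rewrite !inE.
rewrite inE => /andP[eM el].
have [a [b [adjab ee]]] : exists a b, adj a b /\ e = [set a; b].
  case: (tM.1 e eM) => [[x ex]|//]; by rewrite ex /is_loop cards1 in el.
have nab : a != b by exact: tree_neq tT adjab.
have adjba : adj b a by rewrite (tree_sym _ _ tT).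
set M' := M :\ e; have sM' : M' \subset M by exact: subD1set.
have tM' : two_matching adj M' by exact: two_matching_sub tM.
have [|D oD] := IH M' _ tM'.
  rewrite -ltnS; apply: leq_trans lek; rewrite ltnS; apply: proper_card.
  apply/properP; split.
    by apply/subsetP => x; rewrite !inE => /andP[/andP[_ ->]].
  by exists e; rewrite !inE ?eM ?el ?eqxx.
have DM x y : D x y -> [/\ x != y, [set x; y] \in M & [set x; y] != e].
  case: (oD) => + _ _ _ => /[apply] -[xy]; by rewrite !inE => /andP[? ?].
have Dadj x y : D x y -> adj x y.
  by move=> /DM[xy xyM _]; exact: two_matching_adj tM xy xyM.
(* The only tree edge between the two sides is [e], which [D] does not use. *)
have same x y : D x y -> (x \in branch adj b a) = (y \in branch adj b a).
  move=> xy; have [_ _ ne] := DM _ _ xy; have adjxy := Dadj _ _ xy.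
  have [xb|xb] := eqVneq x b; last have [yb|yb] := eqVneq y b.
  - rewrite xb (negbTE (branch_notin tT adjba)); apply/esym/negP => ya.
    case/eqP: ne; rewrite ee xb setUC (branch_exit tT adjba ya) // (tree_sym _ _ tT) -xb //.
  - rewrite yb (negbTE (branch_notin tT adjba)); apply/negP => xa.
    by case/eqP: ne; rewrite ee yb (branch_exit tT adjba xa) // -yb.
  exact: branch_closed.
have Dout x y y' : D x y -> D x y' -> y = y'.
  by case: (oD) => _ _ _ /(_ x); exact: card_le1_eq.
have Din x x' y : D x y -> D x' y -> x = x'.
  by case: (oD) => _ _ /(_ y) + _; apply: (@card_le1_eq _ (fun z => D z y)).
have Dxor x y : D x y -> ~~ D y x by exact: orientation_asym oD.
have abM : [set a; b] \in M by rewrite -ee.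
(* Besides [e], at most one edge of [M] is at its endpoint [c], so no directed path passes through
   [c]. *)
have thru c d x y : [set c; d] = e -> D x c -> D c y -> False.
  move=> cde xc cy; have [nxc xcM xce] := DM _ _ xc; have [ncy cyM cye] := DM _ _ cy.
  have ncd : c != d by rewrite -is_loop_set2 cde.
  have exy : x = y.
    apply: (two_matching_degree (v := c) (a := d) tM) => //; rewrite 1?(eq_sym c) //.
    - by rewrite cde.
    - by rewrite setUC.
    - by apply: contraNneq xce => <-; rewrite setUC cde.
    - by apply: contraNneq cye => <-; rewrite cde.
  by move: (Dxor _ _ xc); rewrite exy cy.
(* The flags record whether [a] has an outgoing edge and [b] an incoming one; a raised flag reverses
   that whole side. *)
pose fa := [exists y, D a y]; pose fb := [exists x, D x b].
pose fl x := if x \in branch adj b a then fa else fb.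
pose D1 x y := if fl x then D y x else D x y.
have D1E x y : D1 x y -> D x y \/ D y x by rewrite /D1; case: ifP; auto.
have flE x y : D1 x y -> fl x = fl y.
  by move=> /D1E[]/same h; rewrite /fl h.
have flD x y : D x y -> fl x = fl y by move=> /same h; rewrite /fl h.
have D1M x y : D1 x y -> [/\ x != y, [set x; y] \in M & [set x; y] != e].
  by move=> /D1E[/DM//|/DM]; rewrite eq_sym setUC.
have D1a y : ~~ D1 a y.
  rewrite /D1 /fl branch_root; case: ifPn => [/existsP[z az]|]; last first.
    by rewrite negb_exists => /forallP.
  by apply/negP => ya; apply: (thru a b _ _ _ ya az).
have D1b x : ~~ D1 x b.
  apply/negP => xb; move: (xb); rewrite /D1 (flE _ _ xb) /fl (negbTE (branch_notin tT adjba)).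
  case: ifPn => [/existsP[z zb] bx|/negP h bx].
    by apply: (thru b a _ _ _ zb bx); rewrite setUC.
  by apply: h; apply/existsP; exists x.
have D1in x x' y : D1 x y -> D1 x' y -> x = x'.
  move=> h h'; move: (h) (h'); rewrite /D1 (flE _ _ h) (flE _ _ h').
  case: ifP => _; [exact: Dout | exact: Din].
have D1out x y y' : D1 x y -> D1 x y' -> y = y'.
  by rewrite /D1; case: ifP => _; [exact: Din | exact: Dout].
pose D2 x y := D1 x y || (x == a) && (y == b).
exists D2; split.
- move=> x y /orP[/D1M[]//|/andP[/eqP-> /eqP->]]; by split.
- move=> e' e'M e'l; have [->|nee'] := eqVneq e' e.
    exists a, b; split=> //; have D1ba : D1 b a = false.
      by apply/negP => /D1M[_ _]; rewrite setUC ee eqxx.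
    by rewrite /D2 D1ba (eq_sym b) (negbTE nab) !eqxx orbT.
  have e'M' : e' \in M' by rewrite !inE nee'.
  have [x [y [exy xy]]] : exists u v, e' = [set u; v] /\ (D u v (+) D v u).
    by case: (oD) => _ + _ _; apply.
  exists x, y; split=> //.
  have nn : (x == a) && (y == b) = false.
    by apply: contraNF nee' => /andP[/eqP xa /eqP yb]; rewrite exy xa yb ee.
  have nn' : (y == a) && (x == b) = false.
    by apply: contraNF nee' => /andP[/eqP xa /eqP yb]; rewrite exy setUC xa yb ee.
  rewrite /D2 nn nn' !orbF /D1.
  have -> : fl y = fl x by case: (boolP (D x y)) xy => [/flD->|_ /flD->].
  by case: (fl x) => //; rewrite addbC.
- move=> y; apply/card_le1_eqP => x x'; rewrite !inE.
  case/orP=> [xy|/andP[/eqP-> /eqP yb]] /orP[x'y|/andP[/eqP-> /eqP yb']] //.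
  + by rewrite (D1in _ _ _ xy x'y).
  + by move: xy; rewrite yb' (negbTE (D1b _)).
  + by move: x'y; rewrite yb (negbTE (D1b _)).
- move=> x; apply/card_le1_eqP => y y'; rewrite !inE.
  case/orP=> [xy|/andP[/eqP xa /eqP->]] /orP[x'y|/andP[/eqP xa' /eqP->]] //.
  + by rewrite (D1out _ _ _ xy x'y).
  + by move: xy; rewrite xa' (negbTE (D1a _)).
  + by move: x'y; rewrite xa (negbTE (D1a _)).
Qed.

Lemma loops_imset (n : nat) (M : {set {set 'I_n}}) :
  loops M = set1 @: loop_vertices M.
Proof.
apply/setP => e; rewrite inE; apply/andP/imsetP => [[eM /cards1P[x ex]]|[x]].
  by exists x; rewrite // inE -ex.
by rewrite inE => xM ->; split=> //; rewrite /is_loop cards1.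
Qed.

(** Looped vertices correspond to loops, and the other heads to the non-loop edges pointing at
    them. *)
Lemma card_heads (n : nat) (adj : rel 'I_n) (M : {set {set 'I_n}}) (D : rel 'I_n) :
  two_matching adj M -> orientation M D -> #|heads M D| = #|M|.
Proof.
move=> tM oD; have DM x y : D x y -> x != y /\ [set x; y] \in M.
  by case: (oD) => + _ _ _; apply.
pose H := [set v | [exists u, D u v]]; pose N := [set e in M | ~~ is_loop e].
rewrite -(cardsID (loop_vertices M) (heads M D)) -(cardsID (loops M) M).
have -> : heads M D :&: loop_vertices M = loop_vertices M.
  by apply/setP => v; rewrite !inE; case: ([set v] \in M); rewrite ?andbF.
have -> : M :&: loops M = set1 @: loop_vertices M.
  by rewrite -loops_imset; apply/setP => e; rewrite !inE; case: (e \in M).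
have -> : M :\: loops M = N.
  by apply/setP => e; rewrite !inE; case: (e \in M); rewrite ?andbF ?andbT.
have -> : heads M D :\: loop_vertices M = H.
  apply/setP => v; rewrite !inE; apply/andP/existsP => [[/negbTE-> /existsP//]|[u uv]].
  split; last by apply/orP; right; apply/existsP; exists u.
  have [nuv uvM] := DM _ _ uv.
  have := two_matching_loop_edge (a := v) (b := u) tM; rewrite inE; apply.
    by rewrite eq_sym.
  by rewrite setUC.
rewrite (card_imset _ set1_inj); congr (_ + _)%N.
pose f v := [set odflt v [pick u | D u v]; v].
have fE u v : D u v -> f v = [set u; v].
  move=> uv; rewrite /f; case: pickP => [u' u'v|/(_ u)]; last by rewrite uv.
  rewrite (_ : u' = u) //; case: (oD) => _ _ /(_ v) + _ => h.
  by apply: (@card_le1_eq _ (fun z => D z v) _ _ h).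
have -> : N = f @: H.
  apply/setP => e; rewrite inE; apply/andP/imsetP => [[eM el]|[v]].
    have [u [v [-> uv]]] : exists u v, e = [set u; v] /\ (D u v (+) D v u).
      by case: (oD) => _ + _ _; apply.
    case: (boolP (D u v)) uv => [uv _|_ /= vu].
      by exists v; rewrite ?(fE _ _ uv) // inE; apply/existsP; exists u.
    by exists u; rewrite ?(fE _ _ vu) 1?setUC // inE; apply/existsP; exists v.
  rewrite inE => /existsP[u uv] ->; rewrite (fE _ _ uv).
  by have [nuv uvM] := DM _ _ uv; rewrite is_loop_set2 uvM nuv.
rewrite card_in_imset // => v v'; rewrite !inE => /existsP[u uv] /existsP[u' u'v'].
rewrite (fE _ _ uv) (fE _ _ u'v') => /(set2_inj (DM _ _ uv).1)[[]//|[eu ev]].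
by move: (orientation_asym oD uv); rewrite eu ev u'v'.
Qed.

Lemma card_tails (n : nat) (adj : rel 'I_n) (M : {set {set 'I_n}}) (D : rel 'I_n) :
  two_matching adj M -> orientation M D -> #|tails M D| = #|M|.
Proof. by move=> tM oD; exact: (card_heads tM (orientation_flip oD)). Qed.

(** * Existence of 2-matchings *)

(** In a tree this says that [Z] lies on a path; the form by branches is what coprimality of leading
    monomials delivers. *)
Definition tripod_free (n : nat) (adj : rel 'I_n) (Z : {set 'I_n}) : Prop :=
  forall v a b c, adj v a -> adj v b -> adj v c -> a != b -> b != c -> c != a ->
    [|| [disjoint Z & branch adj v a], [disjoint Z & branch adj v b] |
        [disjoint Z & branch adj v c]].

(* Root the tree at r in Z and join every vertex whose subtree meets Z to its
   parent: without tripods these edges have degree at most 2 at every vertex. *)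
Lemma tripod_free_two_matching (n : nat) (adj : rel 'I_n) (Z : {set 'I_n}) r :
  is_tree adj -> r \in Z -> tripod_free adj Z ->
  exists M, [/\ two_matching adj M, #|M| = n.-1 & [disjoint Z & loop_vertices M]].
Proof.
move=> tT rZ tf.
(* The neighbour of [v] towards the root. At [r] itself no neighbour qualifies, and the default
   gives [r]. *)
pose par v := odflt v [pick a | adj v a && (r \in branch adj v a)].
have parP v : v != r -> adj v (par v) /\ r \in branch adj v (par v).
  move=> vr; rewrite /par; case: pickP => [a /andP[]//|h].
  have [|a va ra] := @branch_cover _ adj v r tT; first by rewrite eq_sym.
  by have := h a; rewrite /= va ra.
(* The complement of the parent branch is the subtree below [v], so a vertex is active when that
   subtree meets [Z]. *)
pose act : {set 'I_n} := [set v | (v == r) || ~~ (Z \subset branch adj v (par v))].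
pose edge v := [set v; par v].
have edgeN v : v != r -> ~~ is_loop (edge v).
  by move=> /parP[va _]; rewrite is_loop_set2 (tree_neq tT va).
have par_asym v w : v != r -> w != r -> par v = w -> par w = v -> False.
  move=> /parP[vw rv] /parP[wv rw] ev ew; move: rv rw; rewrite ev ew.
  by rewrite ev in vw; rewrite (branch_compl tT vw) in_setC => ->.
(* Every vertex but [r] contributes one element, an edge or a loop, which gives size n - 1. *)
pose M := (edge @: (act :\ r)) :|: (set1 @: ~: act).
have loopM v : ([set v] \in M) = (v \notin act).
  rewrite inE (mem_imset _ _ set1_inj) [X in _ || X]inE; case: imsetP => //= -[x].
  by rewrite in_setD1 => /andP[/edgeN + _] e; rewrite -e /is_loop cards1.
have edgeM e : e \in M -> ~~ is_loop e -> exists v, [/\ v != r, v \in act & e = edge v].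
  rewrite inE => /orP[] /imsetP[v vA ->]; last by rewrite /is_loop cards1.
  by rewrite !in_setD1 in vA; case/andP: vA => vr vA _; exists v.
(* Seen from either endpoint, the edge leads into a branch meeting [Z]: upwards it contains [r],
   downwards a witness that [v] is active. *)
have meets v w : v != r -> v \in act -> w \in edge v ->
    exists2 a, adj w a & ~~ [disjoint Z & branch adj w a] /\ edge v = [set w; a].
  move=> vr vA; have [adjv rv] := parP _ vr; rewrite inE => /orP[]; rewrite inE => /eqP->.
    exists (par v) => //; split=> //; apply/pred0Pn; exists r; by rewrite /= rZ rv.
  exists v; first by rewrite (tree_sym _ _ tT).
  split; last by rewrite /edge setUC.
  move: vA; rewrite inE (negbTE vr) /= => /subsetPn[z zZ zv].
  by apply/pred0Pn; exists z; rewrite /= zZ (branch_compl tT adjv) in_setC zv.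
(* If the parent were inactive, the witness below [v] would also lie towards the grandparent, making
   [v] the parent of its own parent. *)
have inact v w : v != r -> v \in act -> w \in edge v -> w \in act.
  move=> vr vA; have [adjv rv] := parP _ vr; rewrite inE => /orP[]; rewrite inE => /eqP-> //.
  move: vA; rewrite !inE (negbTE vr) /= => /subsetPn[z zZ zv].
  have [//|pr /=] := eqVneq (par v) r; apply/subsetPn; exists z => //.
  apply/negP => zp; have [adjp rp] := parP _ pr; apply: (par_asym v (par v)) => //.
  apply: (@branch_uniq _ adj (par v) _ _ z tT) => //.
    by rewrite (tree_sym _ _ tT).
  by rewrite (branch_compl tT adjv) in_setC zv.
exists M; split.
- split=> [e|v].
    rewrite inE => /orP[] /imsetP[v vA ->]; last by left; exists v.
    right; exists v, (par v); split=> //.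
    by rewrite in_setD1 in vA; case/andP: vA => /parP[].
  rewrite /incidence.
  have [vA|vA] := boolP (v \in act); last first.
    rewrite (_ : [set e in M | _ && _] = set0) ?cards0.
      rewrite add0n -[X in (_ <= X)%N]muln1 leq_mul2l /= -(cards1 [set v]).
      by apply: subset_leq_card; apply/subsetP => e; rewrite !inE => /andP[_].
    apply/setP => e; rewrite in_set0 in_set; apply/negP => /andP[eM /andP[ve el]].
    have [x [xr xA ex]] := edgeM _ eM el.
    by rewrite (inact x v xr xA) // -ex in vA.
  rewrite (_ : [set e in M | e == [set v]] = set0) ?cards0 ?muln0 ?addn0; last first.
    by apply/setP => e; rewrite in_set0 in_set; apply/andP => -[+ /eqP e1]; rewrite e1 loopM vA.
  (* By [meets] each edge at [v] leads to a member of [A], and tripod-freeness bounds [A] by two. *)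
  pose A := [set a | adj v a && ~~ [disjoint Z & branch adj v a]].
  have cA : (#|A| <= 2)%N.
    rewrite leqNgt; apply/card_gt2P => -[a [b [c []]]]; rewrite !inE.
    move=> [/andP[va za] /andP[vb zb] /andP[vc zc]] [ab bc ca].
    by have := tf v a b c va vb vc ab bc ca; rewrite (negbTE za) (negbTE zb) (negbTE zc).
  apply: leq_trans cA; apply: leq_trans (leq_imset_card (fun a => [set v; a]) A).
  apply: subset_leq_card; apply/subsetP => e; rewrite in_set => /andP[eM /andP[ve el]].
  have [x [xr xA ex]] := edgeM _ eM el.
  have [|a va [za ea]] := meets x v xr xA; first by rewrite -ex.
  by apply/imsetP; exists a; rewrite ?ex // inE va za.
- rewrite /M cardsU (_ : _ :&: _ = set0) ?cards0 ?subn0; last first.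
    apply/setP => e; rewrite in_set0 in_setI; apply/negP => /andP[/imsetP[x]].
    rewrite in_setD1 => /andP[/edgeN + _] -> /imsetP[y _ e1].
    by rewrite e1 /is_loop cards1.
  rewrite (card_imset _ set1_inj) card_in_imset; last first.
    move=> x y; rewrite !in_setD1 => /andP[xr _] /andP[yr _] e.
    have [adjx _] := parP _ xr.
    by case: (set2_inj (tree_neq tT adjx) e) => [[]//|[e1 e2]]; case: (par_asym x y).
  have := cardsD1 r act; have := cardsC act; rewrite card_ord inE eqxx /= => e1 e2.
  by apply/eqP; rewrite -eqSS -addSn -add1n -e2 e1 prednK // (leq_ltn_trans _ (ltn_ord r)).
(* A vertex of [Z] lies in its own subtree, hence is active and carries no loop. *)
rewrite disjoint_subset; apply/subsetP => z zZ; rewrite inE [_ \in loop_vertices _]inE loopM negbK.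
rewrite inE; have [//|zr /=] := eqVneq z r; apply/subsetPn; exists z => //.
by apply: branch_notin => //; case: (parP _ zr).
Qed.

(** Descent on the number of loops. *)
Lemma minimal_two_matching_exists (n : nat) (adj : rel 'I_n) (M : {set {set 'I_n}}) :
  two_matching adj M ->
  exists M', minimal_two_matching adj #|M| M' /\ loops M' \subset loops M.
Proof.
have [k] := ubnP #|loops M|; elim: k M => // k IH M lek tM.
have [[M' [tM' cM' pM']]|nM] := classic (exists M', [/\ two_matching adj M', #|M'| = #|M|
    & loops M' \proper loops M]); last by exists M; split.
have [|M'' [mM'' sub]] := IH M' _ tM'.
  by apply: leq_trans (proper_card pM') _; rewrite -ltnS.
exists M''; split; first by rewrite -cM'.
exact: subset_trans sub (proper_sub pM').
Qed.

(** * The Groebner basis *)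

Lemma lp_principal_det (n : nat) (adj : rel 'I_n) (B : {set 'I_n}) :
  lp (principal_det adj B) = mset B.
Proof. by rewrite lp_mlead mlead_principal_det. Qed.

Lemma lc_principal_det (n : nat) (adj : rel 'I_n) (B : {set 'I_n}) :
  lc (principal_det adj B) = 1.
Proof. by rewrite /lc lp_principal_det principal_det_coef. Qed.

Lemma lcN (n : nat) (p : {mpoly int[n]}) : lc (- p) = - lc p.
Proof. by rewrite /lc !lp_mlead mleadN mcoeffN. Qed.

Lemma minor_matching (n : nat) (adj : rel 'I_n) (M : {set {set 'I_n}}) (D : rel 'I_n)
    (f g : 'I_#|M| -> 'I_n) :
  is_tree adj -> two_matching adj M -> #|M| = n.-1 -> orientation M D ->
  strictly_increasing f -> strictly_increasing g ->
  [set f i | i in 'I_#|M|] = heads M D -> [set g i | i in 'I_#|M|] = tails M D ->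
  exists b : bool, \det (mxsub f g (gen_laplacian adj)) =
    (-1) ^+ b * principal_det adj (loop_vertices M).
Proof.
move=> tT tM cM oD fi gi ef eg; have n0 : (0 < n)%N by case: tT.
have [u [w [eu ew ->]]] := minor_cofactor (gen_laplacian adj) n0 cM fi gi.
have [||b ->] := cofactor_matching (u := u) (w := w) tT tM oD _ _.
- by rewrite -ef.
- by rewrite -eg.
by exists (odd (u + w) (+) b); rewrite -[in LHS]signr_odd mulrA signr_addb.
Qed.

(** The principal minor has leading coefficient 1, so the positive sign selects it. Conversely an
    orientation exists, and its heads and tails are sets of size n - 1 that index a minor. *)
Lemma B_setP (n : nat) (adj : rel 'I_n) (p : {mpoly int[n]}) : is_tree adj ->
  B_set adj n.-1 p <-> exists M, minimal_two_matching adj n.-1 M /\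
    p = principal_det adj (loop_vertices M).
Proof.
move=> tT; split=> [[M [mM [D [f [g [[oD fi gi ef eg] [ep lcp]]]]]]]|[M [mM ->]]].
  exists M; split=> //; case: mM => tM cM _.
  have [b eb] := minor_matching tT tM cM oD fi gi ef eg.
  have : p = principal_det adj (loop_vertices M) \/ p = - principal_det adj (loop_vertices M).
    by case: ep => ->; rewrite eb mulr_sign; case: b {eb}; rewrite ?opprK; auto.
  case=> // ep'; by move: lcp; rewrite ep' lcN lc_principal_det.
exists M; split=> //; case: mM => tM cM _.
have [D oD] := orientation_exists tT tM.
(* A set of n - 1 vertices is the complement of one vertex, so [enum_setC1] lists it
   increasingly. *)
have idx (S : {set 'I_n}) : #|S| = #|M| -> exists2 f : 'I_#|M| -> 'I_n,
    strictly_increasing f & [set f i | i in 'I_#|M|] = S.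
  move=> cS; have n0 : (0 < n)%N by case: tT.
  have /cards1P[u eu] : #|~: S| == 1%N.
    by rewrite cardsCs setCK card_ord cS cM -subn1 subKn.
  have [f fi ef] := enum_setC1 u cM.
  by exists f => //; rewrite ef -eu setCK.
have [f fi ef] := idx _ (card_heads tM oD).
have [g gi eg] := idx _ (card_tails tM oD).
exists D, f, g; split; first by split.
split; last by rewrite lc_principal_det.
have [b ->] := minor_matching tT tM cM oD fi gi ef eg.
by rewrite mulr_sign; case: b; rewrite ?opprK; auto.
Qed.

Lemma B_set_ideal (n : nat) (adj : rel 'I_n) (p : {mpoly int[n]}) :
  B_set adj n.-1 p -> I_ideal adj n.-1 p.
Proof.
case=> M [[_ cM _] [D [f [g [[_ fi gi _ _] [ep _]]]]]].
move: f g fi gi ep; rewrite cM => f g fi gi ep.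
have mn : is_minor n.-1 (gen_laplacian adj) (\det (mxsub f g (gen_laplacian adj))).
  by exists f, g.
case: ep => ->; first exact: in_ideal_gen.
by rewrite -mulN1r; apply: in_idealMl; exact: in_ideal_gen.
Qed.

(* Of three branches at v, two avoid the deleted column of the minor. *)
Lemma I_ideal_branches (n : nat) (adj : rel 'I_n) v a b c (p : {mpoly int[n]}) :
  is_tree adj -> adj v a -> adj v b -> adj v c -> a != b -> b != c -> c != a ->
  I_ideal adj n.-1 p ->
  exists q1 q2 q3, p = q1 * principal_det adj (branch adj v a) +
    q2 * principal_det adj (branch adj v b) + q3 * principal_det adj (branch adj v c).
Proof.
move=> tT va vb vc ab bc ca; apply: in_ideal_span3 => _ [f [h [fi hi ->]]].
have n0 : (0 < n)%N by case: tT.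
have [u [w [_ _ ->]]] := minor_cofactor (gen_laplacian adj) n0 erefl fi hi.
rewrite -det_replace_delta_col; move: (_ ^+ _) => sg.
have dj x y : adj v x -> adj v y -> x != y -> [disjoint branch adj v x & branch adj v y].
  move=> vx vy; apply: contraR => /pred0Pn[z /andP[zx zy]].
  by apply/eqP/(branch_uniq tT vx vy zx zy).
have L0 x i0 j : adj v x -> i0 != v -> i0 \notin branch adj v x -> j \in branch adj v x ->
    gen_laplacian adj i0 j = 0.
  move=> vx iv ix jx; rewrite mxE ifN; last by apply: contraNneq ix => ->.
  case: ifP => // ij; have jv : j != v.
    by apply: contraTneq jx => ->; apply: branch_notin.
  by rewrite (branch_closed _ tT iv jv ij) jx in ix.
have two x y : adj v x -> adj v y -> x != y -> w \notin branch adj v x ->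
    w \notin branch adj v y -> exists q q', \det (replace_col w (fun i => (i == u)%:R)
      (gen_laplacian adj)) = q * principal_det adj (branch adj v x) +
      q' * principal_det adj (branch adj v y).
  move=> vx vy xy wx wy.
  apply: (det_replace_col_two_blocks (v := v) _ (dj _ _ vx vy xy)) => //.
  - exact: branch_notin.
  - exact: branch_notin.
  - by move=> i0 j; apply: L0.
  - by move=> i0 j; apply: L0.
have notboth y z : adj v y -> adj v z -> y != z -> w \in branch adj v y ->
    w \notin branch adj v z.
  by move=> vy vz yz wy; rewrite (disjointFr (dj _ _ vy vz yz) wy).
have [wa|wa] := boolP (w \in branch adj v a).
  have [||q [q' ->]] := two b c vb vc bc.
  - exact: notboth wa.
  - by apply: notboth wa => //; rewrite eq_sym.
  move: (principal_det _ (branch adj v a)) (principal_det _ (branch adj v b))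
    (principal_det _ (branch adj v c)) => da db dc.
  by exists 0, (sg * q), (sg * q'); rewrite mul0r add0r mulrDr !mulrA.
have [wb|wb] := boolP (w \in branch adj v b).
  have [||q [q' ->]] := two a c va vc _ wa.
  - by rewrite eq_sym.
  - exact: notboth wb.
  move: (principal_det _ (branch adj v a)) (principal_det _ (branch adj v b))
    (principal_det _ (branch adj v c)) => da db dc.
  by exists (sg * q), 0, (sg * q'); rewrite mul0r addr0 mulrDr !mulrA.
have [q [q' ->]] := two a b va vb ab wa wb.
move: (principal_det _ (branch adj v a)) (principal_det _ (branch adj v b))
    (principal_det _ (branch adj v c)) => da db dc.
by exists (sg * q), (sg * q'), 0; rewrite mul0r addr0 mulrDr !mulrA.
Qed.

(** Distinct branches at [v] are disjoint, so their principal minors have coprime leading monomials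
    and one of these divides [mlead f]. Its branch then contains no vertex whose variable is missing
    from [mlead f]. *)
Lemma I_ideal_lead_tripod_free (n : nat) (adj : rel 'I_n) (f : {mpoly int[n]}) :
  is_tree adj -> I_ideal adj n.-1 f -> f != 0 ->
  tripod_free adj [set i | mlead f i == 0%N].
Proof.
move=> tT If nzf v a b c va vb vc ab bc ca.
have [q1 [q2 [q3 ef]]] := I_ideal_branches tT va vb vc ab bc ca If.
have lcp B : (principal_det adj B)@_(mlead (principal_det adj B)) = 1.
  by rewrite mlead_principal_det principal_det_coef.
have cop x y : adj v x -> adj v y -> x != y ->
    mcoprime (mlead (principal_det adj (branch adj v x)))
             (mlead (principal_det adj (branch adj v y))).
  move=> vx vy xy i; rewrite !mlead_principal_det !mnmE.
  have [ix|_] := boolP (i \in branch adj v x); last by left.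
  have [iy|_] := boolP (i \in branch adj v y); last by right.
  by case/eqP: xy; exact: branch_uniq ix iy.
have dv B : (mlead (principal_det adj B) <= mlead f)%MM ->
    [disjoint [set i | mlead f i == 0%N] & B].
  rewrite mlead_principal_det => /mnm_lepP h; rewrite disjoint_sym disjoint_subset.
  apply/subsetP => i iB; rewrite !inE; have := h i; rewrite mnmE iB.
  by rewrite lt0n.
have := @mlead_coprime3 n _ _ _ q1 q2 q3 (lcp (branch adj v a)) (lcp (branch adj v b))
  (lcp (branch adj v c)) (cop _ _ vb va _) (cop _ _ vc va ca) (cop _ _ vc vb _).
rewrite /= -ef => /(_ _ _ nzf) => -[].
- by rewrite eq_sym.
- by rewrite eq_sym.
- by move/dv=> ->.
- by move/dv=> ->; rewrite orbT.
- by move/dv=> ->; rewrite !orbT.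
Qed.

(** The matching built from the variables missing in [mlead f] has loops only where variables occur;
    minimizing its loops preserves this. *)
Lemma lead_divisible_by_B (n : nat) (adj : rel 'I_n) (f : {mpoly int[n]}) :
  is_tree adj -> I_ideal adj n.-1 f -> f != 0 ->
  exists M, minimal_two_matching adj n.-1 M /\ (mset (loop_vertices M) <= mlead f)%MM.
Proof.
move=> tT If nzf; have tf := I_ideal_lead_tripod_free tT If nzf.
set Z := [set i | mlead f i == 0%N] in tf.
have [M [tM cM dM]] : exists M, [/\ two_matching adj M, #|M| = n.-1 &
    [disjoint Z & loop_vertices M]].
  have [Z0|/set0Pn[r rZ]] := eqVneq Z set0; last exact: tripod_free_two_matching rZ tf.
  have n0 : (0 < n)%N by case: tT.
  (* When every variable occurs, the construction still needs a root and is run on a single vertex,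
     which meets at most one branch at each vertex. *)
  have [||M [tM cM _]] := @tripod_free_two_matching n adj [set Ordinal n0] (Ordinal n0) tT.
  - by rewrite set11.
  - move=> v a b c va vb _ ab _ _; rewrite !disjoints1.
    have [h|//] := boolP (_ \in branch adj v a); apply/orP; right; apply/orP; left.
    by apply: contra ab => h'; apply/eqP/(branch_uniq tT va vb h h').
  by exists M; split=> //; rewrite Z0 disjoints_subset sub0set.
have [M' [mM' sub]] := minimal_two_matching_exists tM.
exists M'; split; first by rewrite -cM.
apply/mnm_lepP => i; rewrite mnmE; have [iM'|//] := boolP (i \in _).
rewrite lt0n; have : i \notin Z; last by rewrite inE.
rewrite (disjointFl dM) //; move: sub; rewrite !loops_imset => /subsetP/(_ [set i]).
by rewrite !mem_imset ?iM' //; [apply | exact: set1_inj | exact: set1_inj].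
Qed.

(** Membership in [B_set] is a proposition, so a finite listing is obtained by classical case
    analysis along a list that contains it. *)
Lemma finite_subpred (T : eqType) (s : seq T) (P : T -> Prop) :
  (forall p, P p -> p \in s) -> exists s' : seq T, forall p, P p <-> p \in s'.
Proof.
elim: s P => [|x s IH] P Ps; first by exists [::] => p; split=> [/Ps|].
have [|s' Hs'] := IH (fun p => P p /\ p != x).
  by move=> p [/Ps]; rewrite inE => /orP[->|].
have [Px|nPx] := classic (P x).
  exists (x :: s') => p; rewrite inE; split=> [Pp|/orP[/eqP->//|/Hs'[]//]].
  by have [//|px] := eqVneq p x; apply/Hs'.
exists s' => p; split=> [Pp|/Hs'[]//]; apply/Hs'; split=> //.
by apply/eqP => px; rewrite px in Pp.
Qed.

Theorem theorem4p8 (n : nat) (adj : rel 'I_n) :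
  is_tree adj ->
  reduced_groebner_basis (I_ideal adj n.-1) (B_set adj n.-1).
Proof.
move=> tT; split.
- split.
  + apply: (@finite_subpred _ [seq principal_det adj B | B : {set 'I_n}]) => p.
    by move/(B_setP _ tT) => [M [_ ->]]; exact: image_f.
  + move=> b Bb; split; last exact: B_set_ideal.
    by case/(B_setP _ tT): Bb => M [_ ->]; exact: principal_det_neq0.
  move=> q; split; apply: in_ideal_sub => t.
    by case=> b [Bb ->]; apply: in_ideal_gen; exists b; split=> //; exact: B_set_ideal.
  case=> f [If ->]; have [->|nzf] := eqVneq f 0.
    by rewrite /lterm /lc mcoeff0 scale0r; exact: in_ideal0.
  have [M [mM le]] := lead_divisible_by_B tT If nzf.
  pose d := principal_det adj (loop_vertices M).
  (* Since [d] is monic, divisibility of monomials already gives divisibility of leading terms. *)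
  have -> : lterm f = (lc f *: 'X_[(mlead f - mset (loop_vertices M))%MM]) * lterm d.
    rewrite /lterm lc_principal_det scale1r lp_principal_det -scalerAl -mpolyXD.
    by rewrite submK // lp_mlead.
  apply: in_idealMl; apply: in_ideal_gen; exists d; split=> //.
  by apply/(B_setP _ tT); exists M.
- by move=> b /(B_setP _ tT)[M [_ ->]]; exact: lc_principal_det.
move=> bi bj /(B_setP _ tT)[M [[tM cM minM] ->]] /(B_setP _ tT)[M' [[tM' cM' _] ->]] ne m mi.
apply/negP; rewrite lp_principal_det => le.
(* Divisibility puts the loops of [M'] inside those of [M]. Minimality of [M] forces equality, and
   then both polynomials are the same principal minor. *)
have : (mset (loop_vertices M') <= mset (loop_vertices M))%MM.
  exact: lepm_trans le (msupp_principal_det mi).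
rewrite mset_lem => sub; apply: minM; exists M'; split=> //.
rewrite !loops_imset properEneq imsetS // andbT.
by apply: contra ne => /eqP/(imset_inj set1_inj) ->.
Qed.
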